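(* Let $r\ge 0$ be a fixed integer and let $\alpha=(\alpha_0,\dots,\alpha_r)$ be fixed positive real numbers such that $\alpha_i\notin\mathbb Z$ for all $i$ and $\alpha_i-\alpha_j\notin\mathbb Z$ for all $i\neq j$. For each $n$, let $Y\subseteq\Delta_n$ be a random simplicial complex distributed according to the upper probability measure $\overline{\mathbb P}_n$ with probability parameters $p_\sigma=n^{-\alpha_i}$ if $\dim\sigma=i\le r$ and $p_\sigma=0$ if $\dim\sigma>r$. Assume that the critical dimension $k^\ast=k^\ast(\alpha)$ satisfies $k^\ast\ge 0$ and that the spread vanishes, $s(\alpha)=0$. Then: (i) the reduced Betti numbers below the critical dimension vanish: for every $0\le i<k^\ast$ one has $\tilde b_i(Y)=0$, a.a.s. (ii) there exist constants $A,B>0$ such that $$A\cdot n^{\beta^\ast}\le b_{k^\ast}(Y)\le B\cdot n^{\beta^\ast},\quad\text{a.a.s.},$$ and for every $j>k^\ast$ there exists $\epsilon_j>0$ such that $$b_j(Y)<n^{-\epsilon_j}\cdot b_{k^\ast}(Y),\quad\text{a.a.s.}$$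
   Context: $[n]=\{0,1,\dots,n\}$; $\Delta_n$ is the simplicial complex of all non-empty subsets (simplexes) of $[n]$, with $\dim\sigma=|\sigma|-1$. A hypergraph is any set $X$ of non-empty subsets of $[n]$; a simplicial complex is a hypergraph closed under taking non-empty subsets (the empty complex is allowed). Given $p_\sigma\in[0,1]$ for each $\sigma\in\Delta_n$, a random hypergraph $X$ includes each $\sigma$ independently with probability $p_\sigma$. Let $\overline X$ be the smallest simplicial complex containing $X$, i.e. all non-empty subsets of members of $X$. The upper measure $\overline{\mathbb P}_n$ on the set of simplicial complexes $Y\subseteq\Delta_n$ is the distribution of $\overline X$. Given the exponents $\alpha_0,\dots,\alpha_r$, put $\beta_i=i+1-\alpha_i$ and $\beta^\ast=\max\{\beta_0,\dots,\beta_r\}$. The critical dimension is $k^\ast=\lfloor\beta^\ast\rfloor$; $i^\ast$ is the unique index in $\{0,\dots,r\}$ with $\beta_{i^\ast}=\beta^\ast$; the spread is $s(\alpha)=i^\ast-k^\ast$ (a non-negative integer). $b_j(Y)$ and $\tilde b_j(Y)$ denote the $j$-th Betti number and the $j$-th reduced Betti number with rational coefficients. ''A.a.s.'' (asymptotically almost surely) means with probability tending to $1$ as $n\to\infty$. *)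

(* Defs.v *)
From HB Require Import structures.
(* finset comes last so that set0, setU11, etc. refer to finite sets. *)
From mathcomp Require Import classical_sets reals topology normedtype sequences exp.
From mathcomp Require Import all_boot all_order all_algebra.

Set Implicit Arguments.
Unset Strict Implicit.
Unset Printing Implicit Defensive.

Import Order.TTheory GRing.Theory Num.Theory.
Import numFieldNormedType.Exports.

Local Open Scope ring_scope.

(* The vertex set {0, ..., n} has n + 1 elements. *)
Notation simplex n := {set 'I_n.+1}.

Section Complexes.
Variable n : nat.
Implicit Types (X Y : {set simplex n}) (s t : simplex n).

Definition Delta : {set simplex n} := [set s | s != set0].

Definition is_hypergraph X : bool := X \subset Delta.

Definition is_complex Y : bool :=
  is_hypergraph Y &&
  [forall s in Y, forall t, (t != set0) && (t \subset s) ==> (t \in Y)].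

Definition generated_complex X : {set simplex n} :=
  [set t | (t != set0) && [exists s in X, t \subset s]].

End Complexes.

Section Homology.
Variable n : nat.

(* Chains of all dimensions live in a single space of functions on the subsets
   of {0, ..., n}, a set of cardinality m being a simplex of dimension m - 1;
   the empty set is the (-1)-simplex used by the augmentation. *)
Definition chain := {ffun simplex n -> rat^o}.

Definition simplex_chain (s : simplex n) : chain :=
  [ffun t : simplex n => (t == s)%:R : rat^o].

(* A simplex s containing v contributes to its facet t = s \ {v} the sign
   (-1)^p, where p = #{w in t | w < v} is the position of v in s. With
   red = true this is the boundary of the augmented chain complex; with
   red = false the component on the empty set is dropped, so that the boundary
   of a 0-chain vanishes. *)
Definition boundary_fun (red : bool) (c : chain) : chain :=
  [ffun t : simplex n =>
    if red || (t != set0) then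
      \sum_(v | v \notin t) (-1) ^+ #|[set w in t | (w < v)%N]| * c (v |: t)
    else 0 : rat^o].

Fact boundary_fun_is_linear red : linear (boundary_fun red).
Proof.
move=> a c d; apply/ffunP=> t; rewrite !ffunE.
case: ifP => _; last by rewrite scaler0 addr0.
rewrite scaler_sumr -big_split /=; apply: eq_bigr => v _.
by rewrite !ffunE mulrDr /GRing.scale /= mulrCA.
Qed.

HB.instance Definition _ red :=
  GRing.isLinear.Build rat chain chain _ (boundary_fun red)
    (boundary_fun_is_linear red).

Definition boundary red : 'End(chain) := linfun (boundary_fun red).

Variable Y : {set simplex n}.

Definition chains (j : nat) : {vspace chain} :=
  <<[seq simplex_chain s | s : simplex n <- enum Y & #|s| == j.+1]>>%VS.

Definition cycles red (j : nat) : {vspace chain} :=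
  (chains j :&: lker (boundary red))%VS.

Definition boundaries red (j : nat) : {vspace chain} :=
  (boundary red @: chains j.+1)%VS.

(* dim (Z_j / B_j); the truncated subtraction is an honest one on complexes,
   by boundaries_sub_cycles. *)
Definition homology_dim red (j : nat) : nat :=
  (\dim (cycles red j) - \dim (boundaries red j))%N.

Definition betti : nat -> nat := homology_dim false.

Definition reduced_betti : nat -> nat := homology_dim true.

Lemma boundary_funK red c : boundary_fun red (boundary_fun red c) = 0.
Proof.
apply/ffunP=> t; rewrite !ffunE; case: ifP => // redt.
pose F (v w : 'I_n.+1) : rat :=
  (-1) ^+ #|[set u in t | (u < v)%N]| *
  ((-1) ^+ #|[set u in v |: t | (u < w)%N]| * c (w |: (v |: t))).
pose P (v w : 'I_n.+1) := (v \notin t) && (w \notin v |: t).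
transitivity (\sum_v \sum_(w | P v w) F v w).
  rewrite big_mkcond /=; apply: eq_bigr => v _; rewrite /P.
  case: ifP => vt; last by rewrite big_pred0.
  rewrite ffunE.
  have -> : v |: t != set0 by apply/set0Pn; exists v; rewrite setU11.
  by rewrite orbT mulr_sumr.
have PC v w : P v w = P w v.
  by rewrite /P !inE !negb_or (eq_sym v w); case: (v \in t);
     case: (w \in t); case: (w == v).
have FC v w : P v w -> F v w = - F w v.
  move=> /andP[vt wvt]; rewrite /F setUCA.
  have wt : w \notin t by move: wvt; rewrite !inE negb_or => /andP[].
  have wv : w != v by move: wvt; rewrite !inE negb_or => /andP[].
  have card x y : x \notin t -> #|[set u in x |: t | (u < y)%N]| =
      ((x < y) + #|[set u in t | (u < y)%N]|)%N.
    move=> xt; case: ltnP => xy.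
      rewrite -[RHS](_ : #|x |: [set u in t | (u < y)%N]| = _).
        apply: eq_card => u; rewrite !inE.
        by case: eqVneq => //= ->; rewrite xy.
      by rewrite cardsU1 !inE (negPf xt).
    apply: eq_card => u; rewrite !inE.
    by case: eqVneq => //= ->; rewrite ltnNge xy (negPf xt).
  rewrite !card // !exprD !mulrA -!mulNr; congr (_ * _).
  have : (v < w)%N = ~~ (w < v)%N.
    by move: wv; rewrite -val_eqE /=; case: ltngtP.
  by move=> ->; case: ltnP => _ /=; rewrite ?expr0 ?expr1 ?mulr1 ?mulrN1
     ?mulNr ?opprK mulrC.
set S := (X in X = _).
suff /eqP : S = - S.
  by rewrite -subr_eq0 opprK -mulr2n -mulr_natr mulf_eq0 orbF => /eqP.
rewrite {1}/S (exchange_big_dep xpredT) //= /S -sumrN.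
apply: eq_bigr => v _; rewrite -sumrN.
by apply: eq_big => w; [rewrite PC | exact: FC].
Qed.

Lemma chain_sum (c : chain) : c = \sum_t c t *: simplex_chain t.
Proof.
apply/ffunP => t; rewrite sum_ffunE (bigD1 t) //= big1 => [|u ut].
  by rewrite !ffunE eqxx addr0 /GRing.scale /= mulr1.
by rewrite !ffunE [t == u]eq_sym (negPf ut) scaler0.
Qed.

Lemma boundaries_sub_cycles red j :
  is_complex Y -> (boundaries red j <= cycles red j)%VS.
Proof.
move=> /andP[_ /forall_inP Ycl].
rewrite subv_cap; apply/andP; split; last first.
  by apply/subvP => _ /memv_imgP[c _ ->]; rewrite memv_ker !lfunE /=
    boundary_funK.
rewrite /boundaries /chains limg_span.
apply/span_subvP => _ /mapP[c /mapP[s sP ->] ->].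
move: sP; rewrite mem_filter mem_enum => /andP[/eqP cs sY].
rewrite lfunE /=.
rewrite [boundary_fun _ _]chain_sum.
apply: memv_suml => t _.
have [->|] := eqVneq (boundary_fun red (simplex_chain s) t) 0.
  by rewrite scale0r mem0v.
move=> nz; apply/memvZ/memv_span/map_f; rewrite mem_filter mem_enum.
have [v vt vts] : exists2 v, v \notin t & v |: t = s.
  case: (pickP (fun v => (v \notin t) && (v |: t == s))) => [v|nex].
    by move=> /andP[vt /eqP vts]; exists v.
  case/eqP: nz; rewrite ffunE; case: ifP => // _; apply: big1 => v vt.
  by move: (nex v); rewrite vt /= ffunE => ->; rewrite mulr0.
have ct : #|t| == j.+1 by move: cs; rewrite -vts cardsU1 vt add1n => -[->].
rewrite ct /=; have /forallP/(_ t)/implyP -> // := Ycl s sY.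
by rewrite -card_gt0 (eqP ct) -vts subsetUr.
Qed.

End Homology.

Section UpperMeasure.
Variables (R : realType) (n : nat) (p : simplex n -> R).

Definition hypergraph_prob (X : {set simplex n}) : R :=
  \prod_(s in Delta n) (if s \in X then p s else 1 - p s).

Definition upper_measure (Y : {set simplex n}) : R :=
  \sum_(X | is_hypergraph X && (generated_complex X == Y)) hypergraph_prob X.

Definition upper_prob (E : pred {set simplex n}) : R :=
  \sum_(Y | is_complex Y && E Y) upper_measure Y.

End UpperMeasure.

Section Exponents.
Variables (R : realType) (r : nat) (alpha : 'I_r.+1 -> R).

Definition simplex_param (n : nat) (s : simplex n) : R :=
  let i := #|s|.-1 in
  if (i <= r)%N then n%:R `^ (- alpha (inord i)) else 0.

(* E holds asymptotically almost surely. *)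
Definition aas (E : forall n, pred {set simplex n}) : Prop :=
  ((fun n : nat => upper_prob (@simplex_param n) (E n)) @ \oo --> (1 : R))%classic.

Definition beta (i : 'I_r.+1) : R := i.+1%:R - alpha i.

Definition beta_max : R := \big[Num.max/beta ord0]_(i < r.+1) beta i.

Definition critical_dim : int := Num.floor beta_max.

(* The index i^*; the maximizer is unique as soon as no difference
   alpha i - alpha j with i != j is an integer. *)
Definition max_index : 'I_r.+1 := [arg max_(i > ord0) beta i]%O.

Definition spread : int := (max_index : nat)%:Z - critical_dim.

End Exponents.

(* Main.v *)
Require Import Defs.
From mathcomp Require Import classical_sets reals topology normedtype sequences exp.
From mathcomp Require Import all_boot all_order all_algebra.
From mathcomp Require Import lra zify.

(** Let [X] be the random hypergraph, [Y] the complex it generates, [k] the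
    critical dimension and [b = beta_max]. Since the spread is zero, [b] is
    [beta alpha k = k + 1 - alpha k] with [0 < alpha k < 1], and every other
    exponent [beta alpha i] is smaller than [b] by a definite amount.

    The number of members of [X] of dimension [i] is about [n ^ (beta i)]. So
    the members of dimension [k] number [n ^ b] up to constants, while those of
    larger dimension number at most [n ^ (b - e)] for some [e > 0]. The faces of
    [Y] of dimension larger than [k] each lie in such a member, whose size is
    bounded, so there are only [O(n ^ (b - e))] of them. A Betti number is at most the number of
    faces, and the Morse inequality bounds [betti Y k] below by the number of
    [k]-faces minus the numbers of [(k+1)]-faces and of [(k-1)]-faces; the
    latter is [O(n ^ k)], which is negligible because [k < b]. This gives the
    bounds on [betti Y k] and the smallness of the higher Betti numbers
    ([aas_betti_bounds]). All probabilities here come from Markov's inequality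
    applied to [z ^ #|X :&: D|] ([hyper_prob_markov]), and the
    exceptional events are stretched exponentially unlikely.

    Below the critical dimension it suffices that the boundaries of the
    [k]-simplices of [X] span all boundaries of [k]-simplices: then [Y] contains
    every simplex of dimension less than [k], and every cycle of dimension less
    than [k] bounds ([spanning_reduced_betti]). Failure of spanning yields a rational cochain
    whose coboundary is nonzero but vanishes on [X]. Clearing denominators and
    dividing by 2 as long as possible makes the coboundary odd somewhere, so
    there is a set [F] of [k]-sets whose set of odd cofaces (its coboundary
    modulo 2) is nonempty and misses [X]. If [F] is taken as small as possible,
    the coboundary expansion of the full simplex says that it has at least
    [#|F| * n.+1 / k.+1] odd cofaces ([sparse_odd_cofaces]). Missing them all
    has probability at most [expR (- (n ^ (1 - alpha k) / k.+1)) ^ #|F|], and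
    the sum over all [F] tends to zero since there are only [O(n ^ k)] sets of
    size [k] ([hyper_prob_nonspanning], [negligible_nonspanning]). *)

Set Implicit Arguments.
Unset Strict Implicit.
Unset Printing Implicit Defensive.

Import Order.TTheory GRing.Theory Num.Theory.
Import numFieldNormedType.Exports.
Local Open Scope ring_scope.

(** * Cochains and the cone formula *)

Section Cochains.
Variable n : nat.
Implicit Types (s t F : simplex n) (v x y : 'I_n.+1) (c : chain n).

Definition position v t : nat := #|[set w in t | (w < v)%N]|.

Lemma position_setU1 x y t : x \notin t ->
  position y (x |: t) = ((x < y)%N + position y t)%N.
Proof.
move=> xt; rewrite /position; case: ltnP => xy.
  rewrite -[RHS](_ : #|x |: [set u in t | (u < y)%N]| = _).
    apply: eq_card => u; rewrite !inE.
    by case: eqVneq => //= ->; rewrite xy.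
  by rewrite cardsU1 !inE (negPf xt).
apply: eq_card => u; rewrite !inE.
by case: eqVneq => //= ->; rewrite ltnNge xy (negPf xt).
Qed.

Lemma position_setD1 v t : position v (t :\ v) = position v t.
Proof.
apply: eq_card => u; rewrite !inE.
by case: eqVneq => //= ->; rewrite ltnn andbF.
Qed.

Lemma augmented_boundaryE c t :
  boundary_fun true c t =
  \sum_(v | v \notin t) (-1) ^+ position v t * c (v |: t).
Proof. by rewrite ffunE. Qed.

Definition coboundary (R : pzRingType) (f : simplex n -> R) s : R :=
  \sum_(v in s) (-1) ^+ position v s * f (s :\ v).

Definition cone v c : chain n :=
  [ffun s : simplex n =>
    if v \in s then (-1) ^+ position v s * c (s :\ v) else 0 : rat^o].

(** The transpose of the cone operator. *)
Definition contraction (R : pzRingType) v (f : simplex n -> R) t : R :=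
  if v \in t then 0 else (-1) ^+ position v t * f (v |: t).

(** The full simplex is contractible: coning off to [v] is a chain homotopy
    from the identity to zero. *)
Lemma cone_homotopy v c :
  boundary_fun true (cone v c) + cone v (boundary_fun true c) = c.
Proof.
apply/ffunP => t; rewrite ffunE augmented_boundaryE [cone v _ t]ffunE.
case: ifPn => vt.
- rewrite augmented_boundaryE.
  rewrite [\sum_(x | x \notin t :\ v) _](bigD1 v) ?setD11 //=.
  rewrite position_setD1 setD1K //.
  rewrite mulrDr mulrA -exprD addnn -signr_odd odd_double mul1r addrCA.
  rewrite mulr_sumr.
  have -> : \sum_(x | (x \notin t :\ v) && (x != v))
      (-1) ^+ position v t * ((-1) ^+ position x (t :\ v) * c (x |: t :\ v))
    = - \sum_(x | x \notin t) (-1) ^+ position x t * cone v c (x |: t).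
    rewrite -sumrN; apply: eq_big => [x|x].
      rewrite !inE negb_and negbK; case: (eqVneq x v) => [->|] /=.
        by rewrite vt.
      by rewrite andbT.
    move=> /andP[+ xv]; rewrite !inE (negPf xv) /= => xt.
    rewrite ffunE !inE vt orbT.
    have -> : (x |: t) :\ v = x |: t :\ v.
      by apply/setP=> u; rewrite !inE; case: (eqVneq u x) => [->|//]; rewrite xv.
    have -> : position x t = ((v < x)%N + position x (t :\ v))%N.
      by rewrite -{1}(setD1K vt) position_setU1 ?setD11.
    rewrite position_setU1 //.
    rewrite !mulrA -mulNr; congr (_ * _).
    have : (v < x)%N = ~~ (x < v)%N.
      by move: xv; rewrite -val_eqE /=; case: ltngtP.
    move=> ->; rewrite !exprD; case: (x < v)%N => /=;
      by rewrite ?expr0 ?expr1 ?mul1r ?mulN1r ?mulrN ?mulNr ?opprK mulrC.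
  by rewrite subrr addr0.
- rewrite addr0 (bigD1 v) //= big1 ?addr0 => [|x /andP[xt xv]].
    rewrite ffunE setU11 position_setU1 // ltnn add0n setU1K //.
    by rewrite mulrA -exprD addnn -signr_odd odd_double mul1r.
  by rewrite ffunE !inE eq_sym (negPf xv) (negPf vt) /= mulr0.
Qed.

Lemma sum_setU1_setD1 (R : pzRingType) v (G : simplex n -> simplex n -> R) :
  \sum_(t : simplex n | v \notin t) G t (v |: t) = \sum_(s : simplex n | v \in s) G (s :\ v) s.
Proof.
rewrite [RHS](reindex_onto (fun t => v |: t) (fun s => s :\ v)) /=; last first.
  by move=> s vs; rewrite setD1K.
apply: eq_big => [t|t vt]; last by rewrite setU1K.
rewrite setU11 /=; apply/idP/eqP => [vt|<-]; first by rewrite setU1K.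
by rewrite setD11.
Qed.

(** Chains and cochains are paired by summing products of values; through the
    two adjunctions below, identities proved for chains pass to cochains. *)
Lemma coboundary_adjoint (f : simplex n -> rat) c :
  \sum_t f t * boundary_fun true c t = \sum_s coboundary f s * c s.
Proof.
transitivity (\sum_v \sum_(t : simplex n | v \notin t)
    f t * ((-1) ^+ position v t * c (v |: t))).
  rewrite (exchange_big_dep xpredT) //=; apply: eq_bigr => t _.
  by rewrite augmented_boundaryE mulr_sumr.
transitivity (\sum_v \sum_(s : simplex n | v \in s)
    (-1) ^+ position v s * f (s :\ v) * c s); last first.
  rewrite (exchange_big_dep xpredT) //=; apply: eq_bigr => s _.
  by rewrite /coboundary mulr_suml.
apply: eq_bigr => v _.
rewrite (@sum_setU1_setD1 _ v
  (fun t s => f t * ((-1) ^+ position v t * c s))).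
by apply: eq_bigr => s vs; rewrite position_setD1 mulrCA mulrA.
Qed.

Lemma contraction_adjoint v (f : simplex n -> rat) c :
  \sum_t contraction v f t * c t = \sum_s f s * cone v c s.
Proof.
transitivity (\sum_(t : simplex n | v \notin t) (-1) ^+ position v t * f (v |: t) * c t).
  rewrite [RHS]big_mkcond; apply: eq_bigr => t _; rewrite /contraction.
  by case: ifP => vt /=; rewrite ?mul0r.
rewrite (@sum_setU1_setD1 _ v (fun t s => (-1) ^+ position v t * f s * c t)).
rewrite [LHS]big_mkcond; apply: eq_bigr => s _; rewrite ffunE.
by case: ifP => vs; rewrite ?mulr0 // position_setD1 mulrCA mulrA.
Qed.

Lemma sum_simplex_chain (f : simplex n -> rat) s :
  \sum_t f t * simplex_chain s t = f s.
Proof.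
rewrite (bigD1 s) //= ffunE eqxx mulr1 big1 ?addr0 // => t /negPf ts.
by rewrite ffunE ts mulr0.
Qed.

(** The cone over a boundary has that same boundary, by [cone_homotopy]; this is
    the transposed identity. *)
Lemma coboundary_contraction_rat v (f : simplex n -> rat) s :
  coboundary (contraction v (coboundary f)) s = coboundary f s.
Proof.
rewrite -[LHS](sum_simplex_chain) -coboundary_adjoint contraction_adjoint.
rewrite -coboundary_adjoint -[RHS]sum_simplex_chain -coboundary_adjoint.
apply: eq_bigr => t _; congr (_ * _).
have := cone_homotopy v (boundary_fun true (simplex_chain s)).
rewrite boundary_funK.
have -> : cone v 0 = 0 by apply/ffunP=> u; rewrite !ffunE mulr0 if_same.
by rewrite addr0 => ->.
Qed.

Lemma coboundary_intr (f : simplex n -> int) s :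
  (coboundary f s)%:~R = coboundary (fun t => (f t)%:~R : rat) s.
Proof.
rewrite /coboundary rmorph_sum; apply: eq_bigr => v _.
by rewrite /= intrM rmorph_sign.
Qed.

Lemma eq_coboundary (R : pzRingType) (f g : simplex n -> R) s :
  f =1 g -> coboundary f s = coboundary g s.
Proof. by move=> fg; apply: eq_bigr => v _; rewrite fg. Qed.

(** Inherited from the rationals, where the pairing with [chain] lives. *)
Lemma coboundary_contraction v (f : simplex n -> int) s :
  coboundary (contraction v (coboundary f)) s = coboundary f s.
Proof.
apply: (@intr_inj rat); rewrite !coboundary_intr.
rewrite -[RHS](coboundary_contraction_rat v); apply: eq_coboundary => t.
rewrite /contraction.
by case: ifP => // _; rewrite intrM rmorph_sign coboundary_intr.
Qed.

End Cochains.

(** * Coboundary expansion modulo 2 *)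

Section OddCochains.
Variable n : nat.
Implicit Types (s t : simplex n) (S F : {set simplex n}).

Definition odd_support (u : simplex n -> int) : {set simplex n} :=
  [set s | ~~ (2 %| u s)%Z].

Definition homogeneous (R : pzRingType) k (f : simplex n -> R) :=
  forall t, #|t| != k -> f t = 0.

Lemma coboundary_homogeneous (R : pzRingType) k (f : simplex n -> R) :
  homogeneous k f -> homogeneous k.+1 (coboundary f).
Proof.
move=> fk s sk; apply: big1 => v vs; rewrite fk ?mulr0 //.
by apply: contra sk => /eqP <-; rewrite (cardsD1 v s) vs.
Qed.

Lemma contraction_homogeneous (R : pzRingType) k v (u : simplex n -> R) :
  homogeneous k.+1 u -> homogeneous k (contraction v u).
Proof.
move=> uk t tk; rewrite /contraction; case: ifPn => // vt.
by rewrite uk ?mulr0 // cardsU1 vt.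
Qed.

Lemma odd_support_homogeneous k (u : simplex n -> int) :
  homogeneous k u -> odd_support u \subset [set s : simplex n | #|s| == k].
Proof.
move=> uk; apply/subsetP => s; rewrite !inE; apply: contraR => /uk ->.
exact: dvdz0.
Qed.

(** If a coboundary has only even values, the contraction of its half is an
    integral cochain, whose coboundary is that half. Absolute values drop, so
    the halving stops, at a coboundary that is odd somewhere. This is what
    makes rational vanishing follow from a statement modulo 2. *)
Lemma odd_coboundary_exists S k (f : simplex n -> int) t0 :
  homogeneous k f -> {in S, forall s, coboundary f s = 0} ->
  coboundary f t0 != 0 ->
  exists g : simplex n -> int, [/\ homogeneous k g,
    [disjoint S & odd_support (coboundary g)] &
    odd_support (coboundary g) != set0].
Proof.
have [m] := ubnP `|coboundary f t0|%N; elim: m f => // m IHm f lem fk fS f0.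
have [even|odd] := eqVneq (odd_support (coboundary f)) set0; last first.
  exists f; split=> //; rewrite -setI_eq0; apply/eqP/setP => s.
  by rewrite !inE; case: (boolP (s \in S)) => // /fS ->; rewrite dvdz0.
pose u s := (coboundary f s %/ 2)%Z.
have uE s : coboundary f s = 2 * u s.
  have : s \notin odd_support (coboundary f) by rewrite even inE.
  by rewrite inE negbK => /divzK; rewrite mulrC.
pose g := contraction ord0 u.
have gE s : 2 * coboundary g s = coboundary f s.
  rewrite -[RHS](@coboundary_contraction n ord0 f) [LHS]mulr_sumr.
  apply: eq_bigr => v _; rewrite mulrCA; congr (_ * _).
  rewrite /g /contraction; case: ifP => _; first by rewrite mulr0.
  by rewrite uE mulrCA.
have gu s : coboundary g s = u s.
  by apply: (@mulfI int 2) => //; rewrite gE uE.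
apply: (IHm g).
- rewrite gu; have := lem; rewrite uE abszM /= => lt.
  have : u t0 != 0 by apply: contra f0; rewrite uE => /eqP->; rewrite mulr0.
  by rewrite -absz_gt0; move: lt; case: `|u t0|%N => // p; rewrite mul2n -addnn
     addSn addnS !ltnS => /(leq_trans _)-> //; rewrite ltnS leq_addr.
- by apply: contraction_homogeneous => t tk; rewrite /u (coboundary_homogeneous fk).
- by move=> s sS; rewrite gu /u fS.
- by apply: contra f0 => /eqP g0; rewrite -gE g0 mulr0.
Qed.

Lemma dvdz_sign_mul m (d x : int) : (d %| (-1) ^+ m * x)%Z = (d %| x)%Z.
Proof. by rewrite !dvdzE abszM abszX exp1n mul1n. Qed.

Definition indicator F : simplex n -> int := fun t => (t \in F)%:R.

(** The coboundary of [F] modulo 2. *)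
Definition odd_cofaces F : {set simplex n} :=
  odd_support (coboundary (indicator F)).

Lemma odd_cofacesE (f : simplex n -> int) :
  odd_cofaces (odd_support f) = odd_support (coboundary f).
Proof.
apply/setP=> s; rewrite !inE; congr (~~ _).
rewrite -[X in (_ %| X)%Z = _](subrK (coboundary f s)) rpredDl //.
rewrite /coboundary -sumrB; apply: rpred_sum => v _.
rewrite -mulrBr; apply: dvdz_mull; rewrite /indicator inE.
have := divz_eq (f (s :\ v)) 2; have := modz_ge0 (f (s :\ v)) (isT : 2 != 0 :> int).
have := ltz_pmod (f (s :\ v)) (isT : 0 < 2 :> int).
have -> : (2 %| f (s :\ v))%Z = ((f (s :\ v) %% 2)%Z == 0).
  exact: (sameP dvdz_mod0P eqP).
case: (f (s :\ v) %% 2)%Z => [[|[|m]]|m] // _ _ {1}->.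
  by rewrite /= addr0 sub0r -mulNr dvdz_mull.
by rewrite /= opprD addrCA subrr addr0 -mulNr dvdz_mull.
Qed.

(** The coboundary expansion of the full simplex. Take [F] of least cardinality
    among the sets with the given odd cofaces. For each vertex [v], the
    contraction of the coboundary of [F] at [v] has the same odd cofaces, and
    has one member for each odd coface that contains [v]; so at least [#|F|] odd
    cofaces contain [v]. Summing over [v] counts each odd coface [k.+1] times. *)
Lemma sparse_odd_cofaces S k (f : simplex n -> int) t0 :
  homogeneous k f -> {in S, forall s, coboundary f s = 0} ->
  coboundary f t0 != 0 ->
  exists F : {set simplex n}, [/\ F != set0, F \subset [set s : simplex n | #|s| == k],
    odd_cofaces F \subset [set s : simplex n | #|s| == k.+1],
    [disjoint S & odd_cofaces F] &
    (n.+1 * #|F| <= k.+1 * #|odd_cofaces F|)%N].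
Proof.
move=> fk fS f0; have [g [gk gS g0]] := odd_coboundary_exists fk fS f0.
pose P F := (F \subset [set s : simplex n | #|s| == k]) &&
  (odd_cofaces F == odd_support (coboundary g)).
have Pg : P (odd_support g).
  by rewrite /P odd_support_homogeneous ?odd_cofacesE ?eqxx.
case: (arg_minnP (fun F => #|F|) Pg) => F /andP[Fk /eqP FE] Fmin.
have Dk : odd_cofaces F \subset [set s : simplex n | #|s| == k.+1].
  by rewrite FE; apply/odd_support_homogeneous/coboundary_homogeneous.
exists F; split=> //.
- apply: contra g0 => /eqP F0; rewrite -FE F0; apply/eqP/setP=> s.
  rewrite !inE; apply: negbF; have -> : coboundary (indicator set0) s = 0.
    by apply: big1 => v _; rewrite /indicator inE mulr0.
  exact: dvdz0.
- by rewrite FE.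
pose u := coboundary (indicator F).
have uk : homogeneous k.+1 u.
  apply: coboundary_homogeneous => t tk; rewrite /indicator.
  by case: (boolP (t \in F)) => // /(subsetP Fk); rewrite inE (negPf tk).
have leF v : (#|F| <= #|[set s in odd_cofaces F | v \in s]|)%N.
  have -> : #|[set s in odd_cofaces F | v \in s]| =
            #|odd_support (contraction v u)|.
    rewrite -(card_in_imset (f := fun s : simplex n => s :\ v)).
      apply: eq_card => t; rewrite !inE /contraction.
      apply/imsetP/idP => [[s]|].
        by rewrite !inE => /andP[us vs] ->; rewrite setD11 setD1K //
          dvdz_sign_mul.
      case: ifPn => [|vt]; first by rewrite dvdz0.
      rewrite dvdz_sign_mul => us.
      by exists (v |: t); rewrite ?setU1K // !inE eqxx andbT.
    move=> s s'; rewrite !inE => /andP[_ vs] /andP[_ vs'] E.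
    by rewrite -(setD1K vs) E setD1K.
  apply: Fmin; rewrite /P (odd_support_homogeneous (contraction_homogeneous _ uk)).
  rewrite /=.
  rewrite odd_cofacesE -FE; apply/eqP/setP=> s.
  by rewrite !inE coboundary_contraction.
rewrite -{1}(card_ord n.+1) -sum_nat_const.
apply: leq_trans (leq_sum _ (fun v _ => leF v)) _.
rewrite mulnC -sum_nat_const.
under eq_bigr => v _ do rewrite -sum1_card.
rewrite (exchange_big_dep (mem (odd_cofaces F))) /=; last first.
  by move=> v s _; rewrite inE => /andP[].
apply: leq_sum => s sF; have /(subsetP Dk) := sF; rewrite inE => /eqP <-.
rewrite sum1_card subset_leq_card //; apply/subsetP => v vF.
have : s \in [set s0 in odd_cofaces F | v \in s0] by [].
by rewrite inE => /andP[].
Qed.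

End OddCochains.

(** * Betti numbers from spanning and from face counts *)

Section Spanning.
Variable n : nat.
Implicit Types (s t : simplex n) (X Y : {set simplex n}) (c : chain n).

Definition faces Y j : {set simplex n} := [set s in Y | #|s| == j.+1].

Lemma span_simplex_chains (l : seq (simplex n)) c s :
  c \in <<[seq simplex_chain t | t <- l]>>%VS -> c s != 0 -> s \in l.
Proof.
move=> /(coord_span (X := in_tuple _)) -> ; apply: contraR => sl.
rewrite sum_ffunE big1 // => i _; rewrite ffunE.
have il : (i < size l)%N by rewrite -(size_map (@simplex_chain n) l).
rewrite (nth_map set0) // ffunE; case: eqP => [sE|_]; last by rewrite scaler0.
by move: sl; rewrite sE mem_nth.
Qed.

Lemma chainsP Y j c :
  reflect (forall s, c s != 0 -> s \in faces Y j) (c \in chains Y j).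
Proof.
apply: (iffP idP) => [cY s cs|cY].
  have := span_simplex_chains cY cs.
  by rewrite mem_filter mem_enum inE andbC.
rewrite [c]chain_sum; apply: memv_suml => s _.
have [->|/cY] := eqVneq (c s) 0; first by rewrite scale0r mem0v.
rewrite inE => /andP[sY cs]; apply/memvZ/memv_span/map_f.
by rewrite mem_filter mem_enum cs.
Qed.

Lemma free_simplex_chains (l : seq (simplex n)) :
  uniq l -> free [seq simplex_chain t | t <- l].
Proof.
elim: l => [|s l IHl] /= => [_|/andP[sl /IHl fl]]; first exact: nil_free.
rewrite free_cons fl andbT; apply: contra sl => /span_simplex_chains; apply.
by rewrite ffunE eqxx oner_neq0.
Qed.

Lemma dim_chains Y j : \dim (chains Y j) = #|faces Y j|.
Proof.
have := free_simplex_chains (filter_uniq (fun s => #|s| == j.+1) (enum_uniq Y)).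
rewrite /chains => /eqP ->.
rewrite size_map -(card_uniqP (filter_uniq _ (enum_uniq _))).
by apply: eq_card => s; rewrite mem_filter mem_enum !inE andbC.
Qed.

Lemma betti_le Y j : (betti Y j <= #|faces Y j|)%N.
Proof.
by rewrite -dim_chains (leq_trans (leq_subr _ _)) // dimvS // capvSl.
Qed.

(** The Morse inequality, with the number of faces of the next lower dimension
    replaced by its largest possible value. *)
Lemma betti_ge Y k :
  (#|faces Y k| <= betti Y k + 'C(n.+1, k) + #|faces Y k.+1|)%N.
Proof.
(* [x], [b]: kernel and image on chains of degree [k.+1]; [z], [m]: the same in
   degree [k]. *)
have arith x b z m f g d : (x + b = g -> z + m = f -> m <= d ->
  f <= z - b + d + g)%N by lia.
rewrite -!dim_chains.
apply: arith (limg_ker_dim (boundary n false) _) (limg_ker_dim _ _) _.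
rewrite -[X in 'C(X, _)]card_ord -card_draws cardE -(size_map (@simplex_chain n)).
apply: leq_trans (dim_span _); apply: dimvS.
apply/subvP => _ /memv_imgP[c /chainsP cY ->].
rewrite [boundary _ _ _]chain_sum; apply: memv_suml => t _; rewrite lfunE /=.
have [->|] := eqVneq (boundary_fun false c t) 0; first by rewrite scale0r mem0v.
rewrite ffunE; case: ifP => [_|_ /eqP//].
move=> nz; apply/memvZ/memv_span/map_f; rewrite mem_enum inE.
have [v /andP[vt cv]] : exists v, (v \notin t) && (c (v |: t) != 0).
  apply/existsP; apply: contraR nz => /existsPn all0; apply/eqP.
  apply: big1 => v vt; have := all0 v; rewrite vt negbK => /eqP->.
  by rewrite mulr0.
by have := cY _ cv; rewrite inE => /andP[_]; rewrite cardsU1 vt.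
Qed.

(** For [X] together with the complete skeleton of dimension [k - 1], this says
    that the reduced homology in degree [k - 1] vanishes. *)
Definition spanning X k :=
  [forall t : simplex n, (#|t| == k.+1) ==>
    (boundary n true (simplex_chain t) \in (boundary n true @: chains X k)%VS)].

Lemma superset_of_card t m :
  (#|t| <= m <= n.+1)%N -> exists2 u : simplex n, t \subset u & #|u| = m.
Proof.
elim: m => [|m IHm] /andP[tm mn].
  by exists t => //; apply/eqP; rewrite -leqn0.
move: tm; rewrite leq_eqVlt => /predU1P[<-|tm]; first by exists t.
have [|u tu um] := IHm; first by rewrite -ltnS tm ltnW.
have /existsP[v vu] : [exists v, v \notin u].
  apply: contraLR mn => /existsPn all_u; rewrite -ltnNge ltnS -um.
  rewrite -[X in (X <= _)%N]card_ord subset_leq_card //; apply/subsetP => v _.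
  by have := all_u v; rewrite negbK.
by exists (v |: u); [exact: subset_trans (subsetUr _ _) | rewrite cardsU1 vu um].
Qed.

Lemma boundary_simplex_facet v t : v \notin t ->
  boundary n true (simplex_chain (v |: t)) t = (-1) ^+ position v t.
Proof.
move=> vt; rewrite lfunE /= augmented_boundaryE (bigD1 v) //= ffunE eqxx mulr1.
rewrite big1 ?addr0 // => x /andP[xt xv]; rewrite ffunE.
case: eqP => [E|_]; last by rewrite mulr0.
have : x \in v |: t by rewrite -E setU11.
by rewrite !inE (negPf xv) (negPf xt).
Qed.

(** A [k]-set [u] occurs with coefficient 1 or -1 in the boundary of any simplex
    having it as a facet, hence also in the boundary of some member of [X]. *)
Lemma spanning_skeleton X k t : (k <= n)%N -> spanning X k ->
  t != set0 -> (#|t| <= k)%N -> t \in generated_complex X.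
Proof.
move=> kn /forallP spX t0 tk; rewrite inE t0 /=.
have [|u tu uk] := @superset_of_card t k; first by rewrite tk leqW.
have [|u' uu' u'k] := @superset_of_card u k.+1.
  by rewrite uk leqnSn ltnS kn.
have [v vu vE] : exists2 v, v \notin u & u' = v |: u.
  have : u' :\: u != set0.
    by rewrite -card_gt0 cardsD (setIidPr uu') uk u'k subSnn.
  move=> /set0Pn[v]; rewrite inE => /andP[vu vu']; exists v => //.
  apply/esym/eqP; rewrite eqEcard cardsU1 vu uk u'k leqnn andbT.
  by rewrite subUset sub1set vu'.
have := spX u'; rewrite u'k eqxx /= => /memv_imgP[d /chainsP dX dE].
have : boundary n true d u != 0.
  by rewrite -dE vE boundary_simplex_facet // signr_eq0.
rewrite lfunE /= augmented_boundaryE => nz.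
have [x /andP[xu dx]] : exists x, (x \notin u) && (d (x |: u) != 0).
  apply/existsP; apply: contraR nz => /existsPn all0; apply/eqP.
  apply: big1 => x xu; have := all0 x; rewrite xu negbK => /eqP->.
  by rewrite mulr0.
have := dX _ dx; rewrite inE => /andP[xX _].
by apply/exists_inP; exists (x |: u) => //; apply: subset_trans (subsetUr _ _).
Qed.

Lemma cone_homogeneous v (c : chain n) m :
  (forall s, c s != 0 -> #|s| = m) -> forall s, cone v c s != 0 -> #|s| = m.+1.
Proof.
move=> cm s; rewrite ffunE; case: ifP => [vs|_ /eqP//].
by rewrite mulf_eq0 signr_eq0 /= => /cm <-; rewrite (cardsD1 v s) vs.
Qed.

(** Every cycle bounds the cone over it. In degree less than [k - 1] this cone is
    a chain of the generated complex, which has the full skeleton; in degree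
    [k - 1] its boundary is also that of a chain of [X], by spanning. *)
Lemma spanning_reduced_betti X k i : (k <= n)%N -> spanning X k ->
  (i < k)%N -> reduced_betti (generated_complex X) i = 0%N.
Proof.
move=> kn spX ik; apply/eqP; rewrite subn_eq0 dimvS //.
apply/subvP => c; rewrite memv_cap memv_ker => /andP[/chainsP cY].
rewrite lfunE /= => /eqP c0.
have cE : c = boundary n true (cone ord0 c).
  rewrite lfunE /= -[LHS](cone_homotopy ord0) c0.
  by rewrite [cone ord0 0](_ : _ = 0) ?addr0 //; apply/ffunP=> u;
     rewrite !ffunE mulr0 if_same.
have ci s : c s != 0 -> #|s| = i.+1 by move=> /cY; rewrite inE => /andP[_ /eqP].
have cone_i := cone_homogeneous ci.
rewrite cE; move: ik; rewrite leq_eqVlt => /predU1P[iE|ik]; last first.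
  apply/memv_img/chainsP => s /cone_i sE; rewrite inE sE eqxx andbT.
  by apply: spanning_skeleton spX _ _; rewrite // -?card_gt0 sE.
have XY : (boundary n true @: chains X k <=
           boundaries (generated_complex X) true i)%VS.
  rewrite /boundaries iE limgS //; apply/subvP => d /chainsP dX.
  apply/chainsP => s /dX; rewrite !inE => /andP[sX sk]; rewrite sk andbT.
  rewrite -card_gt0 (eqP sk); apply/exists_inP; by exists s.
apply: (subvP XY); rewrite [cone _ _]chain_sum linear_sum.
apply: memv_suml => s _; rewrite linearZ /=.
have [->|/cone_i sE] := eqVneq (cone ord0 c s) 0; first by rewrite scale0r mem0v.
by apply: memvZ; have /forallP/(_ s) := spX; rewrite sE iE eqxx.
Qed.

(** A linear form separating some boundary from the boundaries of the
    [k]-simplices of [X] is a rational cochain; clearing denominators gives an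
    integral one. *)
Lemma nonspanning_cochain X k : ~~ spanning X k ->
  exists (f : simplex n -> int) t0, [/\ homogeneous k f,
    {in X, forall s, coboundary f s = 0} & coboundary f t0 != 0].
Proof.
move=> /forallPn[t0]; rewrite negb_imply => /andP[t0k t0W].
set W := (boundary n true @: _)%VS in t0W.
(* [L] vanishes exactly on [W]; one of its coordinates is the linear form. *)
pose L c : chain n := c - projv W c.
have LW c : c \in W -> L c = 0 by move=> cW; rewrite /L projv_id // subrr.
have [u0 Lu0] : exists u0, L (boundary n true (simplex_chain t0)) u0 != 0.
  apply/existsP; apply: contraR t0W => /existsPn all0.
  have : L (boundary n true (simplex_chain t0)) = 0.
    by apply/ffunP => u; have := all0 u; rewrite negbK => /eqP ->; rewrite ffunE.
  by move=> /subr0_eq ->; apply: memv_proj.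
pose f t : rat := if #|t| == k then L (simplex_chain t) u0 else 0.
have fE s : #|s| = k.+1 ->
    coboundary f s = L (boundary n true (simplex_chain s)) u0.
  move=> sk; rewrite -[LHS]sum_simplex_chain -coboundary_adjoint.
  rewrite lfunE /= [X in L X]chain_sum /L linear_sum -sumrB sum_ffunE.
  apply: eq_bigr => t _; rewrite linearZ /= -scalerBr [RHS]ffunE.
  rewrite mulrC /f; case: eqP => // tk.
  rewrite [boundary_fun true _ t](_ : _ = 0) ?mul0r ?scale0r //.
  rewrite augmented_boundaryE big1 // => v vt; rewrite ffunE.
  case: eqP => [E|]; last by rewrite mulr0.
  by case: tk; move: sk; rewrite -E cardsU1 vt => -[].
pose D := \prod_t denq (f t).
pose fz t : int := numq (f t) * \prod_(u | u != t) denq (f u).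
have fzE t : (fz t)%:~R = D%:~R * f t :> rat.
  have -> : D = denq (f t) * \prod_(u | u != t) denq (f u).
    by rewrite /D (bigD1 t).
  by rewrite /fz !intrM numqE [RHS]mulrAC [f t * _]mulrC.
have D0 : D%:~R != 0 :> rat.
  by rewrite intr_eq0; apply/prodf_neq0 => u _; apply: denq_neq0.
have cobE s : (coboundary fz s)%:~R = D%:~R * coboundary f s :> rat.
  rewrite coboundary_intr /coboundary mulr_sumr; apply: eq_bigr => v _.
  by rewrite fzE mulrCA.
have fzk : homogeneous k fz.
  by move=> t /negPf tk; rewrite /fz /f tk mul0r.
exists fz, t0; split=> // [s sX|]; last first.
  by rewrite -(intr_eq0 rat) cobE mulf_neq0 // fE //; apply/eqP.
have [sk|] := eqVneq #|s| k.+1; last exact: coboundary_homogeneous.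
apply/eqP; rewrite -(intr_eq0 rat) cobE fE // LW ?ffunE ?mulr0 //.
apply/memv_img/chainsP => t; rewrite ffunE.
by case: (eqVneq t s) => [->|]; rewrite ?eqxx // inE sX sk eqxx.
Qed.

End Spanning.

(** * Tail bounds for random hypergraphs *)

(** Used both for the law of the random hypergraph and for summing the powers
    [z ^+ #|F|] over all subsets [F] of a set. *)
Lemma prodD_subsets (R : comPzRingType) (T : finType) (K : {set T})
    (g h : T -> R) :
  \prod_(s in K) (g s + h s) =
  \sum_(J : {set T} | J \subset K) \prod_(s in K) (if s \in J then g s else h s).
Proof.
pose F s := if s \in K then g s else 0; pose G s := if s \in K then h s else 1.
transitivity (\prod_s (F s + G s)).
  rewrite big_mkcond; apply: eq_bigr => s _; rewrite /F /G.
  by case: ifP => // _; rewrite add0r.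
rewrite bigA_distr [RHS]big_mkcond; apply: eq_bigr => J _.
case: ifPn => [JK|/subsetPn[s sJ sK]].
  rewrite [RHS]big_mkcond; apply: eq_bigr => s _; rewrite /F /G.
  by case: (boolP (s \in J)) => [/(subsetP JK)->|_] //; case: ifP.
by rewrite (bigD1 s) //= sJ /F (negPf sK) mul0r.
Qed.

Lemma prod_if_exprn (R : comPzRingType) (T : finType) (K J : {set T}) (x : R) :
  \prod_(s in K) (if s \in J then x else 1) = x ^+ #|K :&: J|.
Proof.
rewrite -big_mkcondr /= -prodr_const; apply: eq_bigl => s.
by rewrite inE.
Qed.

Section RandomHypergraph.
Variables (R : realType) (n : nat) (p : simplex n -> R).
Implicit Types (X D F : {set simplex n}) (E : pred {set simplex n}).

Definition hyper_prob E : R :=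
  \sum_(X | is_hypergraph X && E X) hypergraph_prob p X.

Lemma generated_is_complex X : is_complex (generated_complex X).
Proof.
apply/andP; split; first by apply/subsetP=> s; rewrite !inE => /andP[].
apply/forall_inP => s; rewrite inE => /andP[_ /exists_inP[u uX su]].
apply/forallP => t; apply/implyP => /andP[t0 ts]; rewrite inE t0.
by apply/exists_inP; exists u => //; apply: subset_trans ts su.
Qed.

Lemma upper_probE E :
  upper_prob p E = hyper_prob (fun X => E (generated_complex X)).
Proof.
rewrite /hyper_prob (partition_big (@generated_complex n)
  (fun Y => is_complex Y && E Y)) /=; last first.
  by move=> X /andP[_ EX]; rewrite generated_is_complex.
apply: eq_bigr => Y /andP[_ EY]; apply: eq_bigl => X.
by case: eqP => [->|_]; rewrite ?EY ?andbT ?andbF.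
Qed.

Hypothesis p01 : forall s, 0 <= p s <= 1.

Lemma hypergraph_prob_ge0 X : 0 <= hypergraph_prob p X.
Proof.
apply: prodr_ge0 => s _; have /andP[p0 p1] := p01 s.
by case: ifP => _ //; rewrite subr_ge0.
Qed.

Lemma hyper_probT : hyper_prob xpredT = 1.
Proof.
rewrite /hyper_prob (eq_bigl _ _ (fun X => andbT _)) -[LHS]prodD_subsets.
by apply: big1 => s _; rewrite addrC subrK.
Qed.

Lemma hyper_prob_ge0 E : 0 <= hyper_prob E.
Proof. by apply: sumr_ge0 => X _; apply: hypergraph_prob_ge0. Qed.

Lemma hyper_probC E : hyper_prob E = 1 - hyper_prob (fun X => ~~ E X).
Proof.
apply/eqP; rewrite eq_sym subr_eq -hyper_probT /hyper_prob.
rewrite (bigID E) /=; apply/eqP; congr (_ + _); apply: eq_bigl => X.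
  by rewrite andbT.
by rewrite andbT.
Qed.

Lemma union_bound (I : finType) (Q : pred I) (G : I -> pred {set simplex n}) E :
  (forall X, is_hypergraph X -> E X -> exists2 i, Q i & G i X) ->
  hyper_prob E <= \sum_(i | Q i) hyper_prob (G i).
Proof.
move=> EG; rewrite /hyper_prob.
under [leRHS]eq_bigr => i _ do rewrite big_mkcondr.
rewrite exchange_big big_mkcondr; apply: ler_sum => X hX.
case: ifP => [EX|_].
  have [i Qi GiX] := EG X hX EX; rewrite (bigD1 i) //= GiX lerDl.
  by apply: sumr_ge0 => j _; case: ifP => // _; apply: hypergraph_prob_ge0.
by apply: sumr_ge0 => j _; case: ifP => // _; apply: hypergraph_prob_ge0.
Qed.

Lemma hyper_probS E1 E2 : (forall X, is_hypergraph X -> E1 X -> E2 X) ->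
  hyper_prob E1 <= hyper_prob E2.
Proof.
move=> sE; apply: le_trans (union_bound (Q := xpredT) (G := fun _ : unit => E2) _) _.
  by move=> X hX /(sE X hX); exists tt.
by rewrite big_const cardT enumT unlock /= addr0.
Qed.

Lemma hyper_probU E1 E2 :
  hyper_prob (fun X => E1 X || E2 X) <= hyper_prob E1 + hyper_prob E2.
Proof.
pose G b := if b then E1 else E2.
rewrite -(big_bool _ (fun b => hyper_prob (G b))).
by apply: union_bound => X _ /orP[]; [exists true | exists false].
Qed.

Lemma hyper_prob_null E : (forall X, is_hypergraph X -> E X ->
  exists2 s, s \in X & p s = 0) -> hyper_prob E = 0.
Proof.
move=> E0; apply: big1 => X /andP[hX EX]; have [s sX ps] := E0 X hX EX.
by rewrite /hypergraph_prob (bigD1 s) /= ?sX ?ps ?mul0r // (subsetP hX).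
Qed.

(** The members of [X] in [D] are counted by independent indicators, so the
    probability generating function of their number is a product, and
    [1 + x <= expR x] bounds it; together with Markov's inequality this yields
    the three tail estimates below (for [z = 2], [2^-1] and [0]). *)
Lemma hyper_prob_markov D E (z c : R) : D \subset Delta n -> 0 <= z -> 0 <= c ->
  (forall X, E X -> 1 <= c * z ^+ #|X :&: D|) ->
  hyper_prob E <= c * expR ((z - 1) * \sum_(s in D) p s).
Proof.
move=> DD z0 c0 Ez.
have -> : (z - 1) * \sum_(s in D) p s =
  \sum_(s in Delta n) (if s \in D then (z - 1) * p s else 0).
  rewrite mulr_sumr big_mkcond [RHS]big_mkcond; apply: eq_bigr => s _.
  by case: (boolP (s \in D)) => [/(subsetP DD)->|_] //; rewrite if_same.
rewrite expR_sum.
pose g s := if s \in D then z else 1.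
apply: (@le_trans _ _ (c * \prod_(s in Delta n) (p s * g s + (1 - p s)))).
  rewrite prodD_subsets mulr_sumr /hyper_prob big_mkcondr.
  apply: ler_sum => X hX.
  have -> : \prod_(s in Delta n) (if s \in X then p s * g s else 1 - p s) =
            hypergraph_prob p X * z ^+ #|X :&: D|.
    rewrite -prod_if_exprn.
    rewrite [\prod_(s in X) _](_ : _ = \prod_(s in Delta n)
      (if s \in X then g s else 1)).
      rewrite -big_split; apply: eq_bigr => s _ /=.
      by case: ifP; rewrite ?mulr1.
    rewrite big_mkcond [RHS]big_mkcond; apply: eq_bigr => s _.
    by case: (boolP (s \in X)) => [/(subsetP hX)->|_] //; rewrite if_same.
  rewrite mulrCA; case: ifP => [/Ez EX|_].
    by rewrite -[leLHS]mulr1 ler_wpM2l ?hypergraph_prob_ge0.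
  by rewrite !mulr_ge0 ?exprn_ge0 ?hypergraph_prob_ge0.
apply: ler_wpM2l => //; apply: ler_prod => s _; have /andP[p0 p1] := p01 s.
rewrite /g; case: ifP => _; last first.
  by rewrite mulr1 addrC subrK expR0 ler01 lexx.
rewrite addr_ge0 ?subr_ge0 ?mulr_ge0 //=.
by apply: le_trans (expR_ge1Dx _); lra.
Qed.

Lemma hyper_prob_many D (a : R) : D \subset Delta n ->
  hyper_prob (fun X => a <= #|X :&: D|%:R) <= expR (\sum_(s in D) p s - a / 2).
Proof.
move=> DD; rewrite [in leRHS]addrC expRD.
have -> : \sum_(s in D) p s = (2 - 1) * \sum_(s in D) p s by lra.
apply: hyper_prob_markov => //; first exact: expR_ge0.
move=> X aX.
(* From [1 - x <= expR (- x)] at [x = 2^-1]. *)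
have e2 : expR (2^-1) <= 2 :> R.
  have := expR_ge1Dx (- 2^-1 : R); rewrite expRN => h.
  have := expR_gt0 (2^-1 : R) => e0.
  have : (1 + - 2^-1) * expR (2^-1) <= 1 :> R by rewrite -ler_pdivlMr // div1r.
  by lra.
rewrite expRN mulrC ler_pdivlMr ?expR_gt0 // mul1r.
apply: (@le_trans _ _ (expR (#|X :&: D|%:R * 2^-1))).
  by rewrite ler_expR ler_wpM2r ?invr_ge0.
by rewrite expRM_natl lerXn2r ?nnegrE ?expR_ge0.
Qed.

Lemma hyper_prob_few D (a : R) : D \subset Delta n ->
  hyper_prob (fun X => #|X :&: D|%:R <= a) <= expR (a - (\sum_(s in D) p s) / 2).
Proof.
move=> DD; rewrite expRD.
have -> : - ((\sum_(s in D) p s) / 2) = (2^-1 - 1) * \sum_(s in D) p s by lra.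
apply: hyper_prob_markov; rewrite ?expR_ge0 ?invr_ge0 //.
move=> X aX; rewrite exprVn ler_pdivlMr ?exprn_gt0 // mul1r.
apply: (@le_trans _ _ (expR (#|X :&: D|%:R * 1))); last by rewrite mulr1 ler_expR.
rewrite expRM_natl lerXn2r ?nnegrE ?expR_ge0 //.
by have := expR_ge1Dx (1 : R); lra.
Qed.

Lemma hyper_prob_none D : D \subset Delta n ->
  hyper_prob (fun X => [disjoint X & D]) <= expR (- \sum_(s in D) p s).
Proof.
move=> DD; rewrite -mulN1r -[-1]add0r -[leRHS]mul1r.
apply: hyper_prob_markov => // X; rewrite -setI_eq0 => /eqP->.
by rewrite cards0 mul1r.
Qed.

(** The union bound over the obstructions [F] of [sparse_odd_cofaces]. The odd
    cofaces of [F] are all missed with probability at most [z ^+ #|F|], where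
    [z = expR (- (q * n.+1 / k.+1))], and the sum of these powers over the
    nonempty sets [F] of [k]-sets is [(1 + z) ^+ 'C(n.+1, k) - 1]. *)
Lemma hyper_prob_nonspanning k (q : R) :
  0 <= q ->
  (forall s : simplex n, #|s| = k.+1 -> p s = q) ->
  hyper_prob (fun X => ~~ spanning X k) <=
  expR ('C(n.+1, k)%:R * expR (- (q * n.+1%:R / k.+1%:R))) - 1.
Proof.
move=> q0 pq.
set z := expR (- _); pose K : {set simplex n} := [set s : simplex n | #|s| == k].
pose Q F := [&& F \subset K, F != set0,
  odd_cofaces F \subset [set s : simplex n | #|s| == k.+1] &
  (n.+1 * #|F| <= k.+1 * #|odd_cofaces F|)%N].
apply: le_trans (union_bound (Q := Q)
  (G := fun F X => [disjoint X & odd_cofaces F]) _) _.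
  move=> X hX /nonspanning_cochain[f [t0 [fk fX f0]]].
  have [F [F0 FK Fodd FX leF]] := sparse_odd_cofaces fk fX f0.
  by exists F => //; rewrite /Q FK F0 Fodd.
apply: (@le_trans _ _ (\sum_(F : {set simplex n} | Q F) z ^+ #|F|)).
  apply: ler_sum => F /and4P[FK F0 Fodd leF].
  apply: le_trans (hyper_prob_none _) _.
    apply: subset_trans Fodd _; apply/subsetP => s; rewrite !inE => sk.
    by rewrite -card_gt0 (eqP sk).
  rewrite -expRM_natl ler_expR mulrN lerN2.
  rewrite (eq_bigr (fun=> q)) => [|s /(subsetP Fodd)]; last first.
    by rewrite inE => /eqP /pq.
  rewrite sumr_const -[leRHS]mulr_natr -[q * _ / _]mulrA mulrCA ler_wpM2l //.
  by rewrite mulrA ler_pdivrMr // -!natrM ler_nat mulnC [leqRHS]mulnC.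
apply: (@le_trans _ _ (\sum_(F : {set simplex n} | (F \subset K) && (F != set0))
    z ^+ #|F|)).
  rewrite big_mkcond [leRHS]big_mkcond; apply: ler_sum => F _; rewrite /Q.
  have z0 : 0 <= z ^+ #|F| by rewrite exprn_ge0 ?expR_ge0.
  by case: (F \subset K); case: (F != set0) => //=; case: ifP.
have -> : \sum_(F : {set simplex n} | (F \subset K) && (F != set0)) z ^+ #|F| =
    \sum_(F : {set simplex n} | F \subset K) z ^+ #|F| - 1.
  by rewrite [in RHS](bigD1 set0) ?sub0set //= cards0 expr0 addrAC subrr add0r.
have -> : \sum_(F : {set simplex n} | F \subset K) z ^+ #|F| = (1 + z) ^+ #|K|.
  rewrite -prodr_const addrC prodD_subsets; apply: eq_bigr => F FK.
  by rewrite prod_if_exprn (setIidPr FK).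
have -> : #|K| = 'C(n.+1, k) by rewrite card_draws card_ord.
rewrite lerD2r expRM_natl lerXn2r ?nnegrE ?expR_ge0 ?addr_ge0 ?expR_ge0 //.
exact: expR_ge1Dx.
Qed.

End RandomHypergraph.

(** * Faces of the generated complex; limits *)

Section FaceCounts.
Variable n : nat.
Implicit Types (s t : simplex n) (X : {set simplex n}).

Definition simplices_of_dim k : {set simplex n} := [set s : simplex n | #|s| == k.+1].
Definition simplices_above k : {set simplex n} := [set s : simplex n | (k.+1 < #|s|)%N].

Lemma card_subfaces X m : (forall s, s \in X -> (#|s| <= m)%N) ->
  (#|\bigcup_(s in X) powerset s| <= 2 ^ m * #|X|)%N.
Proof.
move=> Xm; rewrite mulnC -sum_nat_const.
apply: (@leq_trans (\sum_(s in X) #|powerset s|)%N).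
  apply: (big_ind2 (fun (A : {set simplex n}) a => (#|A| <= a)%N)) => //.
    by rewrite cards0.
  by move=> A a B b Aa Bb; rewrite (leq_trans (leq_card_setU _ _)) ?leq_add.
by apply: leq_sum => s sX; rewrite card_powerset leq_exp2l // Xm.
Qed.

(** A [j]-face of the generated complex that lies in no member of dimension above
    [k] is itself a member of [X], and then [j] is equal to [k]. *)
Lemma faces_generated_sub X k j : (k <= j)%N ->
  faces (generated_complex X) j \subset
  (if j == k then X :&: simplices_of_dim k else set0)
  :|: \bigcup_(s in X :&: simplices_above k) powerset s.
Proof.
move=> kj; apply/subsetP => t; rewrite !inE.
move=> /andP[/andP[_ /exists_inP[s sX ts]] /eqP tj].
have [js|sj] := ltnP j.+1 #|s|.
  apply/orP; right; apply/bigcupP; exists s; last by rewrite inE.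
  by rewrite !inE sX (leq_ltn_trans _ js).
have ts_eq : t = s by apply/eqP; rewrite eqEcard ts tj.
subst t; move: kj; rewrite leq_eqVlt => /predU1P[kj|kj].
  by rewrite -kj eqxx !inE sX tj kj eqxx.
apply/orP; right; apply/bigcupP; exists s; last by rewrite inE subxx.
by rewrite !inE sX tj.
Qed.

Lemma faces_generated_above X m k j : (forall s, s \in X -> (#|s| <= m)%N) ->
  (k < j)%N ->
  (#|faces (generated_complex X) j| <= 2 ^ m * #|X :&: simplices_above k|)%N.
Proof.
move=> Xm kj; apply: leq_trans (card_subfaces _); last first.
  by move=> s; rewrite inE => /andP[/Xm].
have := faces_generated_sub X (ltnW kj); rewrite gtn_eqF // set0U.
exact: subset_leq_card.
Qed.

Lemma faces_generated_dim X m k : (forall s, s \in X -> (#|s| <= m)%N) ->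
  (#|faces (generated_complex X) k| <=
   #|X :&: simplices_of_dim k| + 2 ^ m * #|X :&: simplices_above k|)%N.
Proof.
move=> Xm; apply: (leq_trans (subset_leq_card (faces_generated_sub X (leqnn k)))).
rewrite eqxx (leq_trans (leq_card_setU _ _)) // leq_add2l card_subfaces //.
by move=> s; rewrite inE => /andP[/Xm].
Qed.

Lemma faces_generated_ge X k :
  (#|X :&: simplices_of_dim k| <= #|faces (generated_complex X) k|)%N.
Proof.
apply/subset_leq_card/subsetP => s; rewrite !inE => /andP[sX sk].
rewrite sk andbT -card_gt0 (eqP sk); apply/exists_inP; by exists s.
Qed.

End FaceCounts.

Section Asymptotics.
Variable R : realType.
Local Open Scope classical_set_scope.

Lemma near_ge_powR (e C : R) : 0 < e -> \forall n \near \oo, C <= n%:R `^ e.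
Proof.
move=> e0; near=> n.
have n_ge : (`|C| + 1) `^ e^-1 <= n%:R by near: n; exact: nbhs_infty_ger.
have C0 : 0 <= `|C| + 1 by rewrite addr_ge0.
apply: (@le_trans _ _ (`|C| + 1)).
  by rewrite (le_trans (ler_norm _)) // lerDl.
apply: (@le_trans _ _ (((`|C| + 1) `^ e^-1) `^ e)).
  by rewrite -powRrM mulVf ?gt_eqF // powRr1.
by apply: ge0_ler_powR; rewrite ?nnegrE ?powR_ge0 // ltW.
Unshelve. all: by end_near. Qed.

Lemma near_powR_dominates (C e f : R) : e < f ->
  \forall n \near \oo, C * n%:R `^ e <= n%:R `^ f.
Proof.
move=> ef; have fe : 0 < f - e by rewrite subr_gt0.
near=> n; have n0 : n%:R != 0 :> R.
  by rewrite pnatr_eq0 -lt0n; near: n; exact: nbhs_infty_gt.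
rewrite -[f](subrK e) powRD ?n0 ?implybT //.
by rewrite ler_wpM2r ?powR_ge0 //; near: n; exact: near_ge_powR.
Unshelve. all: by end_near. Qed.

(** A stretched exponential beats every power, because [expR y] is at least
    [(y / M) ^+ M] for each [M]. *)
Lemma cvg_exprn_expR (c e : R) (m : nat) : 0 < c -> 0 < e ->
  n%:R ^+ m * expR (- (c * n%:R `^ e)) @[n --> \oo] --> (0 : R).
Proof.
move=> c0 e0.
(* Large enough for the bound [expR y >= (y / M) ^+ M] to win a factor [n]. *)
pose M := (Num.bound (m.+1%:R / e)).+1.
have Me : m.+1%:R <= M%:R * e.
  rewrite -ler_pdivrMr //; apply: ltW; apply: lt_trans (archi_boundP _) _.
    by rewrite divr_ge0 // ltW.
  by rewrite ltr_nat.
pose K : R := (M%:R / c) ^+ M.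
have -> : (0 : R) = 2 * K * 0 by rewrite mulr0.
apply: (@squeeze_cvgr _ _ _ _ (fun=> 0) (fun n => 2 * K * n.+1%:R^-1)) => //;
  last 2 first.
- by rewrite mulr0; exact: cvg_cst.
- apply: cvgM; [exact: cvg_cst|exact: cvg_harmonic].
near=> n; set x : R := n%:R; have x1 : 1 <= x.
  by rewrite ler1n; near: n; exact: nbhs_infty_gt.
have x0 : 0 < x by lra.
rewrite mulr_ge0 ?exprn_ge0 ?expR_ge0 ?(ltW x0) //=.
have M0 : 0 < M%:R :> R by rewrite ltr0n.
have K0 : 0 < K by rewrite exprn_gt0 // divr_gt0.
set y := c * _; have y0 : 0 < y by rewrite mulr_gt0 // powR_gt0.
have expy : (y / M%:R) ^+ M <= expR y.
  rewrite -[y in leRHS](mulfVK (lt0r_neq0 M0)) expRM_natr.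
  rewrite lerXn2r ?nnegrE ?expR_ge0 ?divr_ge0 ?(ltW y0) //.
  by rewrite (le_trans _ (expR_ge1Dx _)) // lerDr.
have expNy : expR (- y) <= K / x `^ (e * M%:R).
  rewrite expRN -[leRHS]invrK lef_pV2 ?posrE ?expR_gt0 //; last first.
    by rewrite invr_gt0 divr_gt0 // powR_gt0.
  apply: le_trans expy; rewrite powRrM powR_mulrn ?powR_ge0 //.
  rewrite /K -expr_div_n -exprVn lerXn2r ?nnegrE //.
  - by rewrite invr_ge0 !divr_ge0 ?powR_ge0 ?(ltW c0).
  - by rewrite divr_ge0 ?(ltW y0).
  - by rewrite /y !invfM !invrK -mulrA mulrC.
apply: le_trans (ler_wpM2l _ expNy) _; first by rewrite exprn_ge0 // ltW.
have xM : x ^+ m * x <= x `^ (e * M%:R).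
  by rewrite -exprSr -powR_mulrn ?(ltW x0) // ler_powR // mulrC.
rewrite mulrCA [2 * K]mulrC -[K * 2 / _]mulrA ler_wpM2l ?(ltW K0) //.
rewrite ler_pdivrMr ?powR_gt0 // mulrAC ler_pdivlMr ?ltr0n //.
apply: (@le_trans _ _ (2 * (x ^+ m * x))); last by rewrite ler_wpM2l.
rewrite mulrCA ler_wpM2l ?exprn_ge0 ?(ltW x0) //.
by rewrite -natr1 -/x; lra.
Unshelve. all: by end_near. Qed.

End Asymptotics.

(** * Negligible events and expected numbers of simplices *)

Section BinomialBounds.
Variable R : realType.

Lemma bin_le_exprn (n m : nat) : (0 < n)%N ->
  'C(n.+1, m)%:R <= 2 ^+ m * n%:R ^+ m :> R.
Proof.
move=> n0; rewrite -exprMn -natrM -natrX ler_nat.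
apply: (@leq_trans (n.+1 ^_ m)%N).
  by rewrite -bin_ffact leq_pmulr ?fact_gt0.
rewrite ffact_prod; apply: (@leq_trans (\prod_(i < m) (2 * n))%N).
  by apply: leq_prod => i _; lia.
by rewrite prod_nat_const card_ord.
Qed.

(** The [k.+1] factors of the falling factorial of [n.+1] are at least [n / 2]. *)
Lemma bin_ge_exprn (n k : nat) : (2 * k <= n)%N ->
  n%:R ^+ k.+1 <= (2 ^ k.+1 * k.+1`!)%:R * 'C(n.+1, k.+1)%:R :> R.
Proof.
move=> kn; rewrite -natrX -natrM ler_nat -mulnA [(_`! * _)%N]mulnC bin_ffact.
have const a : (a ^ k.+1 = \prod_(i < k.+1) a)%N by rewrite prod_nat_const card_ord.
rewrite ffact_prod !const -big_split /=.
apply: leq_prod => i _; have := ltn_ord i; lia.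
Qed.

End BinomialBounds.

Section Negligible.
Variables (R : realType) (r : nat) (alpha : 'I_r.+1 -> R).
Hypothesis alpha_gt0 : forall i, 0 < alpha i.
Local Notation param := (@simplex_param R r alpha).
Implicit Types E F : forall n, pred {set simplex n}.

Lemma simplex_param01 n (s : simplex n) : 0 <= param s <= 1.
Proof.
rewrite /simplex_param; case: ifP => _; last by rewrite lexx ler01.
rewrite powR_ge0 /=; case: n s => [|n] s.
  by rewrite powR0 ?ler01 // oppr_eq0 gt_eqF.
by rewrite -[leRHS](powRr0 n.+1%:R) ler_powR ?ler1n // oppr_le0 ltW.
Qed.

Lemma simplex_paramE n (s : simplex n) (i : 'I_r.+1) :
  #|s| = i.+1 -> param s = n%:R `^ (- alpha i).
Proof.
by move=> si; rewrite /simplex_param si /= -ltnS ltn_ord inord_val.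
Qed.

Local Open Scope classical_set_scope.

(** It is convenient to work with the hypergraph rather than with the complex it
    generates, and to show that exceptional events are negligible. *)
Definition negligible (E : forall n, pred {set simplex n}) : Prop :=
  hyper_prob (@param n) (E n) @[n --> \oo] --> (0 : R).

Lemma negligible_bound E (u : nat -> R) :
  (\forall n \near \oo, hyper_prob (@param n) (E n) <= u n) ->
  u n @[n --> \oo] --> (0 : R) -> negligible E.
Proof.
move=> Eu u0; apply: (@squeeze_cvgr _ _ _ _ (fun=> 0) u) => //; last exact: cvg_cst.
near=> n; rewrite (hyper_prob_ge0 (@simplex_param01 n)) /=.
by near: n.
Unshelve. all: by end_near. Qed.

Lemma negligibleS F E : negligible F ->
  (\forall n \near \oo, forall X, is_hypergraph X -> E n X -> F n X) ->
  negligible E.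
Proof.
move=> F0 EF; apply: negligible_bound F0; near=> n.
apply: (hyper_probS (@simplex_param01 n)).
by near: n.
Unshelve. all: by end_near. Qed.

Lemma negligibleU E F : negligible E -> negligible F ->
  negligible (fun n X => E n X || F n X).
Proof.
move=> E0 F0; apply: (negligible_bound (u := fun n =>
  hyper_prob (@param n) (E n) + hyper_prob (@param n) (F n))).
  by near=> n; apply/hyper_probU/simplex_param01.
by rewrite -[0 in X in _ --> X]addr0; apply: cvgD.
Unshelve. all: by end_near. Qed.

Lemma aas_negligible E :
  negligible (fun n X => ~~ E n (generated_complex X)) -> aas alpha E.
Proof.
move=> E0; rewrite /aas.
have -> : (fun n => upper_prob (@param n) (E n)) =
    (fun n => 1 - hyper_prob (@param n) (fun X => ~~ E n (generated_complex X))).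
  by apply/boolp.funext => n; rewrite upper_probE hyper_probC.
by rewrite -[1 in X in _ --> X]subr0; apply: cvgB => //; apply: cvg_cst.
Qed.

Lemma negligible_above_r :
  negligible (fun n X => [exists s in X, (r.+1 < #|s|)%N]).
Proof.
apply: (negligible_bound (u := fun=> 0)); last exact: cvg_cst.
near=> n; rewrite hyper_prob_null // => X _ /exists_inP[s sX rs].
exists s => //; rewrite /simplex_param ifN // -ltnNge.
by rewrite -ltnS prednK // (leq_trans _ rs).
Unshelve. all: by end_near. Qed.

Lemma sum_param_dim n (i : 'I_r.+1) :
  \sum_(s in simplices_of_dim n i) param s =
  'C(n.+1, i.+1)%:R * n%:R `^ (- alpha i).
Proof.
rewrite (eq_bigr (fun=> n%:R `^ (- alpha i))) => [|s]; last first.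
  by rewrite inE => /eqP/simplex_paramE.
by rewrite sumr_const card_draws card_ord mulr_natl.
Qed.

Lemma exprn_powR_beta n (i : 'I_r.+1) : (0 < n)%N ->
  n%:R ^+ i.+1 * n%:R `^ (- alpha i) = n%:R `^ beta alpha i :> R.
Proof.
move=> n0; rewrite /beta powRD ?powR_mulrn ?ler0n //.
by rewrite pnatr_eq0 -lt0n n0 implybT.
Qed.

Lemma sum_param_dim_le n (i : 'I_r.+1) : (0 < n)%N ->
  \sum_(s in simplices_of_dim n i) param s <= 2 ^+ i.+1 * n%:R `^ beta alpha i.
Proof.
move=> n0; rewrite sum_param_dim -exprn_powR_beta // mulrA.
by rewrite ler_wpM2r ?powR_ge0 // bin_le_exprn.
Qed.

Lemma sum_param_dim_ge n (i : 'I_r.+1) : (0 < n)%N -> (2 * i <= n)%N ->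
  (2 ^ i.+1 * i.+1`!)%:R^-1 * n%:R `^ beta alpha i <=
  \sum_(s in simplices_of_dim n i) param s.
Proof.
move=> n0 ni; rewrite sum_param_dim -exprn_powR_beta // mulrA.
rewrite ler_wpM2r ?powR_ge0 // mulrC ler_pdivrMr ?ltr0n ?muln_gt0 ?expn_gt0 ?fact_gt0 //.
by rewrite mulrC bin_ge_exprn.
Qed.

Lemma sum_param_above_le n k (e : R) : (0 < n)%N ->
  (forall i : 'I_r.+1, (k < i)%N -> beta alpha i <= e) ->
  \sum_(s in simplices_above n k) param s <=
  r.+1%:R * 2 ^+ r.+1 * n%:R `^ e.
Proof.
move=> n0 ke.
apply: (@le_trans _ _ (\sum_(s in simplices_above n k)
    \sum_(i < r.+1 | s \in simplices_of_dim n i) n%:R `^ (- alpha i))).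
  apply: ler_sum => s; rewrite inE => sk.
  have [sr|rs] := leqP #|s| r.+1; last first.
    rewrite /simplex_param ifN; last by lia.
    by apply: sumr_ge0 => i _; apply: powR_ge0.
  have si : #|s| = (inord #|s|.-1 : 'I_r.+1).+1 by rewrite inordK; lia.
  rewrite (simplex_paramE si) (bigD1 (inord #|s|.-1)) ?inE -?si //=.
  by rewrite lerDl sumr_ge0 // => i _; apply: powR_ge0.
rewrite (exchange_big_dep (fun i : 'I_r.+1 => (k < i)%N)) /=; last first.
  by move=> s i; rewrite !inE => ks /eqP si; move: ks; rewrite si ltnS.
apply: (@le_trans _ _ (\sum_(i < r.+1) 2 ^+ r.+1 * n%:R `^ e)); last first.
  by rewrite sumr_const card_ord -mulrA mulr_natl.
rewrite big_mkcond; apply: ler_sum => i _; case: ifP => [ki|_]; last first.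
  by rewrite mulr_ge0 ?exprn_ge0 ?powR_ge0.
apply: (@le_trans _ _ (\sum_(s in simplices_of_dim n i) param s)).
  rewrite big_mkcond [leRHS]big_mkcond; apply: ler_sum => s _.
  case: (boolP (s \in simplices_of_dim n i)) => [si|_]; last by rewrite andbF.
  rewrite andbT (simplex_paramE (i := i)); last by move: si; rewrite inE => /eqP.
  by case: ifP => // _; apply: powR_ge0.
apply: le_trans (sum_param_dim_le _ n0) _; apply: ler_pM.
- exact: exprn_ge0.
- exact: powR_ge0.
- by rewrite ler_weXn2l ?ler1n.
- by apply: ler_powR; rewrite ?ler1n // ke.
Qed.

End Negligible.

(** * The random complex with zero spread *)

Section ZeroSpread.
Variables (R : realType) (r : nat) (alpha : 'I_r.+1 -> R) (k : 'I_r.+1) (e : R).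
Hypothesis alpha_gt0 : forall i, 0 < alpha i.
Hypothesis alpha_k_lt1 : alpha k < 1.
Hypothesis e_gt0 : 0 < e.
Hypothesis e_gap : forall i : 'I_r.+1, (k < i)%N ->
  beta alpha i <= beta alpha k - 2 * e.
Hypothesis beta_e_gt0 : 0 < beta alpha k - e.
Local Notation param := (@simplex_param R r alpha).
Local Notation b := (beta alpha k).
Local Open Scope classical_set_scope.

(** The expected number of members of dimension [k] is between [lower_const] and
    [upper_const] times [n ^ b]. *)
Definition lower_const : R := (2 ^ k.+1 * k.+1`!)%:R^-1.
Definition upper_const : R := 2 ^+ k.+1.

Lemma lower_const_gt0 : 0 < lower_const.
Proof. by rewrite invr_gt0 ltr0n muln_gt0 expn_gt0 fact_gt0. Qed.

Lemma beta_k_gt0 : 0 < b.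
Proof. by have := e_gt0; have := beta_e_gt0; lra. Qed.

Lemma simplices_of_dim_Delta n j : simplices_of_dim n j \subset Delta n.
Proof. by apply/subsetP => s; rewrite !inE -card_gt0 => /eqP->. Qed.

Lemma simplices_above_Delta n j : simplices_above n j \subset Delta n.
Proof.
by apply/subsetP => s; rewrite !inE -card_gt0; apply: leq_trans.
Qed.

Lemma cvg_expR_powR (c f : R) : 0 < c -> 0 < f ->
  expR (- (c * n%:R `^ f)) @[n --> \oo] --> (0 : R).
Proof.
move=> c0 f0; rewrite [X in X @ _](_ : _ =
  fun n => n%:R ^+ 0 * expR (- (c * n%:R `^ f))); first exact: cvg_exprn_expR.
by apply/boolp.funext => n; rewrite mul1r.
Qed.

Lemma negligible_few : negligible alpha (fun n X =>
  #|X :&: simplices_of_dim n k|%:R <= lower_const / 4 * n%:R `^ b).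
Proof.
have c0 : 0 < lower_const / 4 by rewrite divr_gt0 ?lower_const_gt0.
apply: (negligible_bound alpha_gt0 _ (cvg_expR_powR c0 beta_k_gt0)).
near=> n; have n0 : (0 < n)%N by near: n; exact: nbhs_infty_gt.
have nk : (2 * k <= n)%N by near: n; exact: nbhs_infty_ge.
apply: le_trans (hyper_prob_few (@simplex_param01 _ _ _ alpha_gt0 n) _
  (simplices_of_dim_Delta n k)) _.
rewrite ler_expR; have := sum_param_dim_ge alpha n0 nk.
by rewrite -/lower_const; lra.
Unshelve. all: by end_near. Qed.

Lemma negligible_many : negligible alpha (fun n X =>
  4 * upper_const * n%:R `^ b <= #|X :&: simplices_of_dim n k|%:R).
Proof.
have c0 : 0 < upper_const by rewrite exprn_gt0.
apply: (negligible_bound alpha_gt0 _ (cvg_expR_powR c0 beta_k_gt0)).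
near=> n; have n0 : (0 < n)%N by near: n; exact: nbhs_infty_gt.
apply: le_trans (hyper_prob_many (@simplex_param01 _ _ _ alpha_gt0 n) _
  (simplices_of_dim_Delta n k)) _.
rewrite ler_expR; have := sum_param_dim_le alpha k n0.
by rewrite -/upper_const; lra.
Unshelve. all: by end_near. Qed.

Lemma negligible_above : negligible alpha (fun n X =>
  n%:R `^ (b - e) <= #|X :&: simplices_above n k|%:R).
Proof.
have c0 : 0 < 4^-1 :> R by rewrite invr_gt0.
apply: (negligible_bound alpha_gt0 _ (cvg_expR_powR c0 beta_e_gt0)).
near=> n; have n0 : (0 < n)%N by near: n; exact: nbhs_infty_gt.
apply: le_trans (hyper_prob_many (@simplex_param01 _ _ _ alpha_gt0 n) _
  (simplices_above_Delta n k)) _.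
rewrite ler_expR; have := sum_param_above_le n0 e_gap.
have : 4 * (r.+1%:R * 2 ^+ r.+1) * n%:R `^ (b - 2 * e) <= n%:R `^ (b - e) :> R.
  by near: n; apply: near_powR_dominates; have := e_gt0; lra.
by lra.
Unshelve. all: by end_near. Qed.

(** A given [k]-set lies in about [n ^ (1 - alpha k)] members of [X] of
    dimension [k], far more than the logarithm of the number of [k]-sets. *)
Lemma negligible_nonspanning : negligible alpha (fun n X => ~~ spanning X k).
Proof.
have d0 : 0 < 1 - alpha k by rewrite subr_gt0.
have c0 : 0 < k.+1%:R^-1 :> R by rewrite invr_gt0 ltr0n.
apply: (negligible_bound alpha_gt0 (u := fun n => expR (2 ^+ k *
  (n%:R ^+ k * expR (- (k.+1%:R^-1 * n%:R `^ (1 - alpha k))))) - 1)); last first.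
  rewrite -[0 in X in _ --> X](subrr 1) -[1 in X in _ --> X - _]expR0.
  apply: cvgB; last exact: cvg_cst.
  apply: continuous_cvg; first exact: continuous_expR.
  rewrite -[0 in X in _ --> X](mulr0 (2 ^+ k)).
  by apply: cvgM; [exact: cvg_cst | exact: cvg_exprn_expR].
near=> n; have n0 : (0 < n)%N by near: n; exact: nbhs_infty_gt.
have -> : n%:R `^ (1 - alpha k) = n%:R * n%:R `^ (- alpha k) :> R.
  by rewrite powRD ?powRr1 // pnatr_eq0 -lt0n n0 implybT.
apply: le_trans (hyper_prob_nonspanning (@simplex_param01 _ _ _ alpha_gt0 n)
  (powR_ge0 n%:R (- alpha k)) (fun s => @simplex_paramE R r alpha n s k)) _.
rewrite lerD2r ler_expR mulrA ler_pM ?expR_ge0 ?ler0n ?bin_le_exprn //.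
rewrite ler_expR lerN2 mulrC ler_wpM2r ?invr_ge0 // mulrC.
by rewrite ler_wpM2l ?powR_ge0 // ler_nat.
Unshelve. all: by end_near. Qed.

Lemma aas_reduced_betti i : (i < k)%N ->
  aas alpha (fun n Y => reduced_betti Y i == 0%N).
Proof.
move=> ik.
apply: aas_negligible.
apply: (negligibleS alpha_gt0 negligible_nonspanning).
near=> n => X _; apply: contra => spX.
have kn : (k <= n)%N by near: n; exact: nbhs_infty_ge.
by rewrite (spanning_reduced_betti kn spX ik).
Unshelve. all: by end_near. Qed.

Definition betti_bounds n (Y : {set simplex n}) : Prop :=
  lower_const / 8 * n%:R `^ b <= (betti Y k)%:R
    <= (4 * upper_const + 2 ^+ r.+1) * n%:R `^ b
  /\ forall j, (k < j)%N ->
    (betti Y j)%:R < n%:R `^ (- (e / 2)) * (betti Y k)%:R.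

(** Every face of dimension above [k] of the complex lies in a member of [X] of
    dimension above [k]; those are rare, so the Morse inequalities leave only
    the members of dimension [k] itself. *)
Lemma aas_betti_bounds (E : forall n, pred {set simplex n}) :
  (\forall n \near \oo, forall Y : {set simplex n}, betti_bounds Y -> E n Y) ->
  aas alpha E.
Proof.
move=> EP; apply: aas_negligible.
apply: (negligibleS alpha_gt0 (negligibleU alpha_gt0
  (negligibleU alpha_gt0 negligible_few negligible_many)
  (negligibleU alpha_gt0 negligible_above (negligible_above_r alpha_gt0)))).
near=> n => X _; apply: contraR; rewrite !negb_or.
move=> /andP[/andP[few many] /andP[above /exists_inPn large]].
have n0 : (0 < n)%N by near: n; exact: nbhs_infty_gt.
have Xr s : s \in X -> (#|s| <= r.+1)%N by move=> /large; rewrite -leqNgt.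
set Y := generated_complex X.
move: few many above; rewrite -!ltNge => few many above.
set m := #|X :&: simplices_above n k| in above.
have face_gt j : (k < j)%N -> (#|faces Y j|)%:R <= 2 ^+ r.+1 * m%:R :> R.
  by move=> kj; rewrite -natrX -natrM ler_nat faces_generated_above.
have face_le : (#|faces Y k|)%:R <=
    #|X :&: simplices_of_dim n k|%:R + 2 ^+ r.+1 * m%:R :> R.
  by rewrite -natrX -natrM -natrD ler_nat faces_generated_dim.
have face_ge : #|X :&: simplices_of_dim n k|%:R <= (#|faces Y k|)%:R :> R.
  by rewrite ler_nat faces_generated_ge.
have morse : (#|faces Y k|)%:R <=
    (betti Y k)%:R + 2 ^+ k * n%:R `^ k%:R + (#|faces Y k.+1|)%:R :> R.
  have := betti_ge Y k; rewrite -(ler_nat R) !natrD => /le_trans-> //.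
  by rewrite lerD2r lerD2l powR_mulrn // bin_le_exprn.
have c0 := lower_const_gt0.
(* The bound [lower_const / 4 * n ^ b] on the number of [k]-faces loses at most
   half of its value to these two terms. *)
have n_k : 16 / lower_const * 2 ^+ k * n%:R `^ k%:R <= n%:R `^ b :> R.
  near: n; apply: near_powR_dominates; rewrite /beta -natr1.
  by have := alpha_k_lt1; lra.
have n_e : 16 / lower_const * 2 ^+ r.+1 * n%:R `^ (b - e) <= n%:R `^ b :> R.
  by near: n; apply: near_powR_dominates; have := e_gt0; lra.
have n_b : n%:R `^ (b - e) <= n%:R `^ b :> R.
  by rewrite ler_powR ?ler1n //; have := e_gt0; lra.
have n_e2 : (2 ^+ r.+1 / (lower_const / 8)) * n%:R `^ (b - e) <= n%:R `^ (b - e / 2) :> R.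
  by near: n; apply: near_powR_dominates; have := e_gt0; lra.
have r0 : 0 < 2 ^+ r.+1 :> R by rewrite exprn_gt0.
have above' : 2 ^+ r.+1 * m%:R < 2 ^+ r.+1 * n%:R `^ (b - e) :> R.
  by rewrite ltr_pM2l.
have lower : lower_const / 8 * n%:R `^ b <= (betti Y k)%:R.
  (* Clears the denominator, for linear arithmetic. *)
  have scale x y z : 16 / lower_const * x * y <= z -> 16 * (x * y) <= lower_const * z.
    by rewrite -mulrA mulrAC ler_pdivrMr // [z * _]mulrC.
  have := scale _ _ _ n_k; have := scale _ _ _ n_e.
  by have := face_gt _ (ltnSn k); lra.
have EPn : forall Y : {set simplex n}, betti_bounds Y -> E n Y by near: n.
apply: EPn; split.
- rewrite lower /=; apply: (@le_trans _ _ (#|faces Y k|)%:R).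
    by rewrite ler_nat betti_le.
  have : 2 ^+ r.+1 * n%:R `^ (b - e) <= 2 ^+ r.+1 * n%:R `^ b :> R.
    by rewrite ler_pM2l.
  by lra.
- move=> j kj; apply: (@lt_le_trans _ _
    (n%:R `^ (- (e / 2)) * (lower_const / 8 * n%:R `^ b))).
    apply: (@le_lt_trans _ _ (#|faces Y j|)%:R); first by rewrite ler_nat betti_le.
    apply: (le_lt_trans (face_gt j kj)); apply: (lt_le_trans above').
    rewrite mulrCA -powRD ?pnatr_eq0 -?lt0n ?n0 ?implybT // [- _ + _]addrC.
    by move: n_e2; rewrite mulrAC ler_pdivrMr ?divr_gt0 // [_ * (lower_const / 8)]mulrC.
  by rewrite ler_wpM2l ?powR_ge0.
Unshelve. all: by end_near. Qed.

End ZeroSpread.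

(** * The exponents, and the theorem *)

Section Exponents.
Variables (R : realType) (r : nat) (alpha : 'I_r.+1 -> R).

Lemma beta_le_max_index i : beta alpha i <= beta alpha (max_index alpha).
Proof. by rewrite /max_index; case: Order.TotalTheory.arg_maxP => // j _; apply. Qed.

Lemma beta_max_index : beta_max alpha = beta alpha (max_index alpha).
Proof.
apply/le_anti; rewrite le_bigmax_cond // andbT.
by apply/bigmax_leP; split=> [|i _]; apply: beta_le_max_index.
Qed.

Hypothesis alpha_notint : forall i, alpha i \isn't a Num.int.
Hypothesis alphaB_notint : forall i j, i != j -> alpha i - alpha j \isn't a Num.int.
Hypothesis spread_eq0 : spread alpha = 0.

Lemma critical_dim_max_index : critical_dim alpha = max_index alpha.
Proof. by apply/esym/eqP; rewrite -subr_eq0; apply/eqP. Qed.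

Lemma alpha_max_index_lt1 : alpha (max_index alpha) < 1.
Proof.
rewrite lt_neqAle; apply/andP; split.
  by apply: contra (alpha_notint (max_index alpha)) => /eqP->; rewrite rpred1.
have /andP[+ _] := floor_itv (beta_max alpha).
by rewrite -/(critical_dim alpha) critical_dim_max_index beta_max_index
  /beta -natr1 -pmulrn; lra.
Qed.

(** The maximum of the [beta i] is attained only once, so the finitely many
    other values stay away from it. *)
Lemma beta_gap : exists2 e : R, 0 < e &
  (forall i, i != max_index alpha ->
    beta alpha i <= beta alpha (max_index alpha) - 2 * e) /\
  0 < beta alpha (max_index alpha) - e.
Proof.
set k := max_index alpha; have a1 := alpha_max_index_lt1.
pose g := \big[Num.min/1 - alpha k]_(i | i != k) (beta alpha k - beta alpha i).
have g0 : 0 < g.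
  apply/lt_bigmin; rewrite ?subr_gt0 // => i ik.
  rewrite subr_gt0 lt_neqAle beta_le_max_index andbT.
  apply: contra (alphaB_notint ik) => /eqP E.
  have -> : alpha i - alpha k = i%:R - k%:R by move: E; rewrite /beta -!natr1; lra.
  by rewrite rpredB ?rpred_nat.
(* The default value [1 - alpha k] of the minimum serves the second conjunct. *)
exists (g / 2); first by rewrite divr_gt0.
split=> [i ik|].
  have : g <= beta alpha k - beta alpha i by apply: bigmin_le_cond.
  by lra.
have : g <= 1 - alpha k by apply: bigmin_le_id.
rewrite /beta -natr1; have : 0 <= (k : nat)%:R :> R by [].
by move: a1; rewrite -/k; lra.
Qed.

End Exponents.

Theorem theorem12p2 (R : realType) (r : nat) (alpha : 'I_r.+1 -> R)
    (alpha_gt0 : forall i, 0 < alpha i)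
    (alpha_notint : forall i, alpha i \isn't a Num.int)
    (alphaB_notint : forall i j, i != j -> alpha i - alpha j \isn't a Num.int)
    (critical_dim_ge0 : 0 <= critical_dim alpha)
    (spread_eq0 : spread alpha = 0) :
  let k := `|critical_dim alpha|%N in
  [/\ forall i : nat, (i < k)%N ->
        aas alpha (fun n Y => reduced_betti Y i == 0%N),
      exists A B : R, [/\ 0 < A, 0 < B &
        aas alpha (fun n Y =>
          A * n%:R `^ beta_max alpha <= (betti Y k)%:R
            <= B * n%:R `^ beta_max alpha)] &
      forall j : nat, (k < j)%N -> exists eps : R, 0 < eps /\
        aas alpha (fun n Y =>
          (betti Y j)%:R < n%:R `^ (- eps) * (betti Y k)%:R)].
Proof.
move=> k; have kE : k = max_index alpha :> nat by rewrite /k critical_dim_max_index.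
have [e e0 [gap be0]] := beta_gap alpha_notint alphaB_notint spread_eq0.
have gap' (i : 'I_r.+1) : (max_index alpha < i)%N ->
    beta alpha i <= beta alpha (max_index alpha) - 2 * e.
  by move=> ki; apply: gap; rewrite -val_eqE /= gtn_eqF.
have a1 := alpha_max_index_lt1 alpha_notint spread_eq0.
rewrite beta_max_index {}kE; split=> [i ik||j kj].
- exact: (aas_reduced_betti alpha_gt0 a1 ik).
- exists (lower_const R (max_index alpha) / 8).
  exists (4 * upper_const R (max_index alpha) + 2 ^+ r.+1).
  split.
  + by rewrite divr_gt0 ?lower_const_gt0.
  + by rewrite addr_gt0 ?mulr_gt0 ?exprn_gt0.
  by apply: (aas_betti_bounds alpha_gt0 a1 e0 gap' be0); near=> n => Y [].
- exists (e / 2); split; first by rewrite divr_gt0.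
  by apply: (aas_betti_bounds alpha_gt0 a1 e0 gap' be0); near=> n => Y [_]; apply.
Unshelve. all: by end_near. Qed.
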